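(* Let $d\ge2$ be a nonsquare integer with fundamental solution $(X_1,Y_1)$ of $x^2-dy^2=1$. Let $K>X_1$ be an integer and let $w$ be a positive integer with $2^w\ge d^2K^4$. Then Program QT (defined in the context), on input $d,K,w$, returns $(X_1,Y_1)$. Each of its two packed integers $M_x,M_y$ has at most $2wK^3$ binary digits. All intermediates outside the Hamming-weight subroutine have $O(wK^3)$ binary digits.
   Context: The fundamental solution is the solution of $x^2-dy^2=1$ in positive integers with $X_1$ least. All values are in $\mathbb N=\{0,1,2,\dots\}$; $u\mathbin{\dot{-}}v=\max(u-v,0)$; $u\bmod v$ is the remainder; divisors are positive. The constants implied by $O(\cdot)$ are absolute. Intermediates are all values computed while evaluating the assignments; those ''outside the Hamming-weight subroutine'' are all except the ones computed inside the calls $\mathsf H(M_x),\mathsf H(M_y)$ below. Subroutine $\mathsf G_{024}(Q,K,t)$ returns $(G_0,G_2,G_4)$ computed by: $u=Q\mathbin{\dot{-}}1$, $Z_Q=Q^K$, $v=ut$, $Q_+=Q+1$, $u_3=u^3$, $G_0=\lfloor Z_Q/u\rfloor$, $z=v\mathbin{\dot{-}}2$, $g_2=vz+Q_+$, $G_2=\lfloor Z_Qg_2/u_3\rfloor$, $u_5=u^5$, $h=Q_+(Q+9)$, $g_4=g_2g_2+Q\bigl((4v)(z\mathbin{\dot{-}}Q_+)+h\bigr)$, $G_4=\lfloor Z_Qg_4/u_5\rfloor$. A fourth argument, when present, supplies the already computed value $Z_Q=Q^K$. Subroutine $\mathsf H(m)$ (Hamming weight, default form): $a=2m$, $L=2^a$,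 $\alpha=\lfloor(L+1)^a/L^m\rfloor\bmod L$, $e=a$, $\Pi=L$, $\gamma=\alpha\Pi$, $g=\Bigl(\Bigl\lfloor\frac{2^{\gamma(\gamma+\alpha+\Pi)}}{(2^{\gamma\alpha}\mathbin{\dot{-}}1)(2^{\gamma\Pi}\mathbin{\dot{-}}1)}\Bigr\rfloor\bmod2^\gamma\Bigr)\mathbin{\dot{-}}1$, $u=\Pi\mathbin{\dot{-}}1$, output $\lfloor(g^e\bmod u^2)/u\rfloor$. Subroutine $\mathsf T(U,V)$, for triples $U=(U_0,U_2,U_4)$, $V=(V_0,V_2,V_4)$ and with $d,d_2,P,P_-$ supplied: $D_2=dV_2$; it returns $P_-\bigl[\bigl(V_0(PU_0\mathbin{\dot{-}}U_4)+2U_2(V_0+D_2)\bigr)\mathbin{\dot{-}}U_0(2D_2+d_2V_4)\bigr]$. Subroutine $\mathsf R(d,A,B)$: $V_B=d(BB)$, $c=(AA\mathbin{\dot{-}}A)\mathbin{\dot{-}}V_B$, $V_c=cc$, $D_c=V_c\mathbin{\dot{-}}V_B$; it returns the pair $\bigl(\lfloor(V_c+V_B)/D_c\rfloor,\ \lfloor(2B)c/D_c\rfloor\bigr)$. Program QT, with input $d,K,w$ (local variables of subroutines are separate): QT1. $t=K\mathbin{\dot{-}}1$, $P=2^w$, $P_-=P\mathbin{\dot{-}}1$, $q=PP$, $q_1=q^K$, $q_2=q_1^K$, $Q=q_1q_2$. QT2. $U=(U_0,U_2,U_4)=\mathsf G_{024}(Q,K,t)$, $V=(V_0,V_2,V_4)=\mathsf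 G_{024}(q,K,t,q_1)$, $d_2=dd$, $T_x=\mathsf T(U,V)$, $T_y=\mathsf T(V,U)$. QT3. $D_q=q_2\mathbin{\dot{-}}1$, $M_x=\lfloor T_x/D_q\rfloor$, $M_y=\lfloor T_y/D_q\rfloor$ (the packed integers), $H_x=\mathsf H(M_x)$, $H_y=\mathsf H(M_y)$, $\sigma=\lfloor(KK)t/2\rfloor$, $A=\lfloor H_x/w\rfloor\mathbin{\dot{-}}\sigma$, $B=\lfloor H_y/w\rfloor\mathbin{\dot{-}}\sigma$. QT4. Return $\mathsf R(d,A,B)$. *)

(* Defs.v *)
From mathcomp Require Import all_boot.

Set Implicit Arguments.
Unset Strict Implicit.
Unset Printing Implicit Defensive.

(* The truncated subtraction of nat is harmless: it yields 1 exactly when the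
   integer difference is 1. *)
Definition pell_solution (d x y : nat) : Prop :=
  [/\ 0 < x, 0 < y & x ^ 2 - d * y ^ 2 = 1].

Definition fundamental_solution (d X Y : nat) : Prop :=
  pell_solution d X Y /\ (forall x y, pell_solution d x y -> X <= x).

(* Number of binary digits; 0 is written with one digit. *)
Definition binary_digits (n : nat) : nat := (trunc_log 2 n).+1.

(* A computation yields [None] when it divides by zero, and otherwise its
   result together with the list of all the values it has computed. *)
Definition comp (A : Type) : Type := option (A * seq nat).

Definition ret (A : Type) (a : A) : comp A := Some (a, [::]).

Definition bind (A B : Type) (c : comp A) (k : A -> comp B) : comp B :=
  if c is Some (a, s) then
    if k a is Some (b, s') then Some (b, s ++ s') else None
  else None.

(* Runs a subroutine but records its result only, not the values computed
   inside it. *)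
Definition hide_inside (c : comp nat) : comp nat :=
  if c is Some (a, _) then Some (a, [:: a]) else None.

Inductive binop := OpAdd | OpSub | OpMul | OpPow | OpDiv | OpMod.

Definition apply_op (op : binop) (m n : nat) : option nat :=
  match op with
  | OpAdd => Some (m + n)
  | OpSub => Some (m - n)
  | OpMul => Some (m * n)
  | OpPow => Some (m ^ n)
  | OpDiv => if 0 < n then Some (m %/ n) else None
  | OpMod => if 0 < n then Some (m %% n) else None
  end.

(* A leaf is a numeral or the current value of a variable. *)
Inductive expr := Leaf of nat | Bin of binop & expr & expr.

Coercion Leaf : nat >-> expr.

Declare Scope expr_scope.
Delimit Scope expr_scope with E.
Bind Scope expr_scope with expr.

(* Every operation records its value; leaves record nothing, being constants,
   inputs or values recorded earlier. *)
Fixpoint eval (e : expr) : comp nat :=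
  match e with
  | Leaf n => ret n
  | Bin op e1 e2 =>
      bind (eval e1) (fun m => bind (eval e2) (fun n =>
        if apply_op op m n is Some r then Some (r, [:: r]) else None))
  end.

Notation "e1 + e2" := (Bin OpAdd e1 e2) : expr_scope.
Notation "e1 - e2" := (Bin OpSub e1 e2) : expr_scope.
Notation "e1 * e2" := (Bin OpMul e1 e2) : expr_scope.
Notation "e1 ^ e2" := (Bin OpPow e1 e2) : expr_scope.
Notation "e1 %/ e2" := (Bin OpDiv e1 e2) : expr_scope.
Notation "e1 %% e2" := (Bin OpMod e1 e2) : expr_scope.

Notation "'let*' x := e 'in' k" := (bind (eval e%E) (fun x => k))
  (at level 200, x name, e at level 100, k at level 200,
   format "'[v' 'let*'  x  :=  e  'in' '/' k ']'").
Notation "'call*' x := c 'in' k" := (bind c (fun x => k))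
  (at level 200, x name, c at level 100, k at level 200,
   format "'[v' 'call*'  x  :=  c  'in' '/' k ']'").

Definition G024 (Q K t : nat) (ZQ0 : option nat) : comp (nat * nat * nat) :=
  let* u := Q - 1 in
  call* ZQ := (if ZQ0 is Some Z then ret Z else eval (Q ^ K)) in
  let* v := u * t in
  let* Qp := Q + 1 in
  let* u3 := u ^ 3 in
  let* G0 := ZQ %/ u in
  let* z := v - 2 in
  let* g2 := v * z + Qp in
  let* G2 := (ZQ * g2) %/ u3 in
  let* u5 := u ^ 5 in
  let* h := Qp * (Q + 9) in
  let* g4 := g2 * g2 + Q * ((4 * v) * (z - Qp) + h) in
  let* G4 := (ZQ * g4) %/ u5 in
  ret (G0, G2, G4).

Definition H (m : nat) : comp nat :=
  let* a := 2 * m in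
  let* L := 2 ^ a in
  let* alpha := (((L + 1) ^ a) %/ (L ^ m)) %% L in
  let* e := a in
  let* Pi := L in
  let* gamma := alpha * Pi in
  let* g := (((2 ^ (gamma * (gamma + alpha + Pi)))
                %/ ((2 ^ (gamma * alpha) - 1) * (2 ^ (gamma * Pi) - 1)))
               %% (2 ^ gamma)) - 1 in
  let* u := Pi - 1 in
  eval (((g ^ e) %% (u ^ 2)) %/ u).

Definition T (d d2 P Pm : nat) (U V : nat * nat * nat) : comp nat :=
  let: (U0, U2, U4) := U in
  let: (V0, V2, V4) := V in
  let* D2 := d * V2 in
  eval (Pm * ((V0 * (P * U0 - U4) + (2 * U2) * (V0 + D2))
              - U0 * (2 * D2 + d2 * V4))).

Definition R (d A B : nat) : comp (nat * nat) :=
  let* VB := d * (B * B) in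
  let* c := (A * A - A) - VB in
  let* Vc := c * c in
  let* Dc := Vc - VB in
  let* x := (Vc + VB) %/ Dc in
  let* y := ((2 * B) * c) %/ Dc in
  ret (x, y).

(* [output] is what the program returns; [Mx] and [My] keep the values of the
   two packed integers. *)
Record outcome := Outcome { Mx : nat; My : nat; output : nat * nat }.

Definition QT (d K w : nat) : comp outcome :=
  let* t := K - 1 in
  let* P := 2 ^ w in
  let* Pm := P - 1 in
  let* q := P * P in
  let* q1 := q ^ K in
  let* q2 := q1 ^ K in
  let* Q := q1 * q2 in
  call* U := G024 Q K t None in
  call* V := G024 q K t (Some q1) in
  let* d2 := d * d in
  call* Tx := T d d2 P Pm U V in
  call* Ty := T d d2 P Pm V U in
  let* Dq := q2 - 1 in
  let* mx := Tx %/ Dq in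
  let* my := Ty %/ Dq in
  call* Hx := hide_inside (H mx) in
  call* Hy := hide_inside (H my) in
  let* sigma := ((K * K) * t) %/ 2 in
  let* A := Hx %/ w - sigma in
  let* B := Hy %/ w - sigma in
  call* xy := R d A B in
  ret (Outcome mx my xy).

(* Main.v *)
Require Import Defs.
From mathcomp Require Import all_boot ssralg zify ring.

(** Write P = 2^w, q = P^2 and Q = q^(K + K^2).  The subroutine [G024] evaluates
    closed forms of the moments sum_(k < K) k^j B^k for j = 0, 2, 4
    ([G024_computes]), and [T] combines them so that
      T_x = sum_(a, b < K) Q^a q^b (P - 1) (P + 1 - (a^2 - d b^2 - 1)^2)
    ([T_computes]).  The squared quantity, the Pell defect of (a, b), is at most P,
    so each coefficient is a 2w-bit cell.  It is P^2 - 1, of Hamming weight 2w, when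
    (a, b) solves the Pell equation.  Otherwise it is (2^w - 1) s with
    0 < s <= 2^w, and such a number always has Hamming weight w
    ([hamming_weight_mul_ones]).

    Division by q^(K^2) - 1 turns the factor q^(K^2 a) of Q^a into the geometric
    series 1 + ... + q^(K^2 (a - 1)).  Hence the packed integer M_x contains the
    cell (a, b) exactly a times, at disjoint positions ([divide_packed]), and its
    Hamming weight is w (sigma + A), where sigma = K^2 (K - 1) / 2 and A is the sum
    of the x-coordinates of the solutions below K.  In T_y the roles of a and b
    are exchanged, and the same count gives the sum B of the y-coordinates.

    The subroutine [H] returns the Hamming weight h of m because 2^h is the exact
    power of two dividing the central binomial coefficient C(2m, m), by Kummer's
    theorem ([logn_central_bin]).  That coefficient is read off as a digit of a
    power of L + 1; its gcd with L, which is 2^h, is read off as a digit of a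
    quotient that counts lattice points on a line ([gcd_digit]); and h is read off
    2^h modulo (L - 1)^2 ([discrete_log]).

    Finally, the solutions below K are the powers of e = X_1 + Y_1 sqrt(d) up to
    some exponent n ([pell_complete]), so s = A + B sqrt(d) is the geometric
    sum 1 + e + ... + e^n.  With s' its conjugate and c = A^2 - A - d B^2, one has
    c + B sqrt(d) = s' (s - 1) and c - B sqrt(d) = s (s' - 1), whose ratio is e.
    The routine [R] rationalizes this ratio.

    All recorded values are at most Q^(30 K), which is at most 2^(120 w K^3). *)

Set Implicit Arguments.
Unset Strict Implicit.
Unset Printing Implicit Defensive.

(** * Running a computation *)

(** The recorded values are only constrained by [S]: the same rules serve for
    bounding them all and, with [S] trivial, for an unrecorded subroutine. *)
Definition computes (S : pred nat) (A : Type) (c : Defs.comp A) (a : A) : Prop :=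
  exists2 s, c = Some (a, s) & all S s.

Lemma computes_ret S A (a : A) : computes S (ret a) a.
Proof. by exists [::]. Qed.

Lemma computes_bind S A B (c : Defs.comp A) (k : A -> Defs.comp B) a b :
  computes S c a -> computes S (k a) b -> computes S (bind c k) b.
Proof.
case=> s -> Ss [s' ks' Ss']; exists (s ++ s'); first by rewrite /= ks'.
by rewrite all_cat Ss.
Qed.

Lemma computes_bin S op (e1 e2 : expr) m n r :
  computes S (eval e1) m -> computes S (eval e2) n ->
  apply_op op m n = Some r -> S r -> computes S (eval (Bin op e1 e2)) r.
Proof.
move=> c1 c2 opr Sr /=; apply: computes_bind c1 _; apply: computes_bind c2 _.
by rewrite opr; exists [:: r]; rewrite //= Sr.
Qed.

Lemma computes_leaf S (n : nat) : computes S (eval n) n.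
Proof. exact: computes_ret. Qed.

Lemma computes_div S e1 e2 m n :
  computes S (eval e1) m -> computes S (eval e2) n ->
  0 < n -> S (m %/ n) -> computes S (eval (e1 %/ e2)%E) (m %/ n).
Proof. by move=> c1 c2 n_gt0; apply: computes_bin c1 c2 _; rewrite /= n_gt0. Qed.

Lemma computes_mod S e1 e2 m n :
  computes S (eval e1) m -> computes S (eval e2) n ->
  0 < n -> S (m %% n) -> computes S (eval (e1 %% e2)%E) (m %% n).
Proof. by move=> c1 c2 n_gt0; apply: computes_bin c1 c2 _; rewrite /= n_gt0. Qed.

Lemma computes_hide (S : pred nat) c a :
  computes predT c a -> S a -> computes S (hide_inside c) a.
Proof. by case=> s -> _ Sa; exists [:: a]; rewrite //= Sa. Qed.

(** The value enters the continuation through an equation, so that a proof may keep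
    it abstract or rewrite it into a convenient form first. *)
Lemma computes_let S A e (k : nat -> Defs.comp A) m b :
  computes S (eval e) m -> (forall x, x = m -> computes S (k x) b) ->
  computes S (bind (eval e) k) b.
Proof. by move=> ce ck; apply: computes_bind ce _; apply: ck. Qed.

Ltac run_expr :=
  lazymatch goal with
  | |- computes _ (eval (Leaf _)) _ => exact: computes_leaf
  | |- computes _ (eval (Bin OpDiv _ _)) _ =>
      eapply computes_div; [run_expr | run_expr | | ]
  | |- computes _ (eval (Bin OpMod _ _)) _ =>
      eapply computes_mod; [run_expr | run_expr | | ]
  | |- computes _ (eval (Bin _ _ _)) _ =>
      eapply computes_bin; [run_expr | run_expr | reflexivity | ]
  end.

(** * Powers as size bounds *)

Lemma leq_powD B m n x y : 1 < B -> x <= B ^ m -> y <= B ^ n ->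
  x + y <= B ^ (maxn m n).+1.
Proof.
move=> B1 xm yn.
have hx : x <= B ^ maxn m n by apply: leq_trans xm _; rewrite leq_exp2l // leq_maxl.
have hy : y <= B ^ maxn m n by apply: leq_trans yn _; rewrite leq_exp2l // leq_maxr.
by rewrite expnS; apply: leq_trans (leq_mul B1 (leqnn _)); lia.
Qed.

Lemma leq_powM B m n x y : x <= B ^ m -> y <= B ^ n -> x * y <= B ^ (m + n).
Proof. by rewrite expnD; apply: leq_mul. Qed.

Lemma leq_powB B m x y : x <= B ^ m -> x - y <= B ^ m.
Proof. by apply: leq_trans; apply: leq_subr. Qed.

Lemma leq_pow_div B m x y : x <= B ^ m -> x %/ y <= B ^ m.
Proof. by apply: leq_trans; apply: leq_div. Qed.

Lemma leq_pow_exp B m n x : x <= B ^ m -> x ^ n <= B ^ (m * n).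
Proof. by move=> xm; rewrite expnM; case: n => [|n] //; rewrite leq_exp2r. Qed.

Lemma leq_pow1 B x : x <= B -> x <= B ^ 1.
Proof. by []. Qed.

(** Bounds an arithmetic term by a power of a fixed base, building the exponent along
    the term; hypotheses of the form x <= B ^ m are used at the leaves. *)
Ltac bound :=
  lazymatch goal with
  | |- is_true (_ + _ <= _) => eapply leq_powD; [ lia | bound | bound ]
  | |- is_true (_ - _ <= _) => eapply leq_powB; bound
  | |- is_true (_ * _ <= _) => eapply leq_powM; bound
  | |- is_true (_ %/ _ <= _) => eapply leq_pow_div; bound
  | |- is_true (_ ^ _ <= _) => first [eassumption | eapply leq_pow_exp; bound]
  | |- _ => first [ eassumption | eapply leq_pow1; lia ]
  end.

Lemma leq_pow_trans B x m n : 1 < B -> x <= B ^ m -> m <= n -> x <= B ^ n.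
Proof. by move=> B1 xm mn; apply: leq_trans xm _; rewrite leq_exp2l. Qed.

(** [S_bd] turns a bound by a power of the base into membership in the predicate
    that the recorded values must satisfy. *)
Ltac run_let S_bd :=
  apply: computes_let => [|? ->];
  [ run_expr; solve [done | eapply S_bd; [bound | lia]] | ].

(** * Moments of a geometric progression *)

Definition moment (K j B : nat) := \sum_(k < K) k ^ j * B ^ k.

(** An equation between sums of naturals follows from another one when the two differ
    by a polynomial identity; stated by crossing the sides, to avoid subtraction. *)
Lemma eq_of_cross_addn (l r l' r' : nat) : l = r -> l' + r = r' + l -> l' = r'.
Proof. by move=> ->; apply: addIn. Qed.

(* In the closed forms below, [u] is B - 1 and the negative terms have been moved to
   the other side. *)

Lemma moment0_closed u t : u.+1 ^ t.+1 = u * moment t.+1 0 u.+1 + 1.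
Proof.
elim: t => [|t IH]; first by rewrite /moment big_ord_recr big_ord0 /=; ring.
rewrite /moment big_ord_recr [u.+1 ^ t.+2]expnS /= -/(moment _ _ _).
by apply: eq_of_cross_addn IH _; ring.
Qed.

Lemma moment2_closed u t :
  u.+1 ^ t.+1 * ((u * t) ^ 2 + (u + 2))
  = u ^ 3 * moment t.+1 2 u.+1 + u.+1 ^ t.+1 * (2 * (u * t)) + u.+1 * (u + 2).
Proof.
elim: t => [|t IH]; first by rewrite /moment big_ord_recr big_ord0 /=; ring.
rewrite /moment big_ord_recr [u.+1 ^ t.+2]expnS /= -/(moment _ _ _).
by apply: eq_of_cross_addn IH _; ring.
Qed.

(** The last summand is the remainder of the division that computes the moment; its
    coefficients 1, 11, 11, 1 are the Eulerian numbers. *)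
Lemma moment4_closed u t :
  u.+1 ^ t.+1 * ((u * t) ^ 4 + 6 * (u * t) ^ 2 * (u + 2)
                 + (u.+1 ^ 3 + 11 * u.+1 ^ 2 + 11 * u.+1 + 1))
  = u ^ 5 * moment t.+1 4 u.+1
    + u.+1 ^ t.+1 * (4 * (u * t) ^ 3 + 4 * (u * t) * (u.+1 ^ 2 + 4 * u.+1 + 1))
    + u.+1 * (u.+1 ^ 3 + 11 * u.+1 ^ 2 + 11 * u.+1 + 1).
Proof.
elim: t => [|t IH]; first by rewrite /moment big_ord_recr big_ord0 /=; ring.
rewrite /moment big_ord_recr [u.+1 ^ t.+2]expnS /= -/(moment _ _ _).
by apply: eq_of_cross_addn IH _; ring.
Qed.

Lemma eulerian4_small u : 20 <= u ->
  u.+1 * (u.+1 ^ 3 + 11 * u.+1 ^ 2 + 11 * u.+1 + 1) < u ^ 5.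
Proof.
move=> hu.
have step n : 20 * u ^ n <= u ^ n.+1 by rewrite expnS leq_mul2r hu orbT.
have -> : u.+1 * (u.+1 ^ 3 + 11 * u.+1 ^ 2 + 11 * u.+1 + 1)
          = u ^ 4 + 15 * u ^ 3 + 50 * u ^ 2 + 60 * u ^ 1 + 24 by ring.
by move: (step 4) (step 3) (step 2) (step 1) (step 0); lia.
Qed.

Lemma moment_le K j B : 0 < K <= B -> 1 < B -> moment K j B <= B ^ (K + j).
Proof.
case: K => // K; case: B => // u KB u0; rewrite addnC expnD.
apply: (@leq_trans (u.+1 ^ j * moment K.+1 0 u.+1)).
  rewrite /moment big_distrr; apply: leq_sum => k _ /=.
  rewrite mul1n leq_mul2r; apply/orP; right.
  by case: j => // j; rewrite leq_exp2r //; have := ltn_ord k; lia.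
by rewrite leq_mul2l (moment0_closed u K); apply/orP; right; nia.
Qed.

Lemma divn_euclid a b q r : a = b * q + r -> r < b -> a %/ b = q.
Proof.
by move=> -> rb; rewrite mulnC divnMDl ?(leq_ltn_trans _ rb) // divn_small ?addn0.
Qed.

(** [G024] evaluates the closed forms, in which the negative terms of the numerator are
    regrouped so that no truncated subtraction ever truncates (this needs K > 2);
    the remainder left by each closed form is smaller than the divisor. *)
Lemma G024_computes (S : pred nat) B K ZQ0 :
  20 < B -> 2 < K <= B -> (ZQ0 = None \/ ZQ0 = Some (B ^ K)) ->
  (forall v, v <= B ^ (K + 12) -> S v) ->
  computes S (G024 B K (K - 1) ZQ0) (moment K 0 B, moment K 2 B, moment K 4 B).
Proof.
case: B => // u; case: K => // t u20 /andP[t2 tu] ZQ Sle.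
have B1 : 1 < u.+1 by lia.
have S_bd m v : v <= u.+1 ^ m -> m <= t.+1 + 12 -> S v.
  by move=> vm mK; apply: Sle; apply: leq_pow_trans B1 vm mK.
rewrite /G024; apply: computes_let => [|_ ->]; first run_expr.
  by eapply S_bd; [bound | lia].
apply: (@computes_bind _ _ _ _ _ (u.+1 ^ t.+1)).
  case: ZQ => ->; last exact: computes_ret.
  by run_expr; eapply S_bd; [bound | lia].
have -> : u.+1 - 1 = u by lia.
have -> : t.+1 - 1 = t by lia.
have Z_le : u.+1 ^ t.+1 <= u.+1 ^ t.+1 by [].
have [r ut] : exists r, u * t = r + u + 4 by exists (u * t - (u + 4)); nia.
have u0 : 0 < u by lia.
do ![apply: computes_let => [|_ ->]; first by
  (run_expr; first [by rewrite ?expn_gt0 u0 | eapply S_bd; [bound | lia]])].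
have -> : u.+1 ^ t.+1 %/ u = moment t.+1 0 u.+1.
  by apply: divn_euclid (moment0_closed u t) _; lia.
have -> : u.+1 ^ t.+1 * (u * t * (u * t - 2) + (u.+1 + 1)) %/ u ^ 3
          = moment t.+1 2 u.+1.
  apply: (@divn_euclid _ _ _ (u.+1 * (u + 2))); last by nia.
  apply: eq_of_cross_addn (moment2_closed u t) _.
  have -> : u * t - 2 = r + u + 2 by lia.
  by rewrite ut; ring.
set g := (X in _ * X %/ u ^ 5).
have -> : u.+1 ^ t.+1 * g %/ u ^ 5 = moment t.+1 4 u.+1.
  apply: divn_euclid (eulerian4_small _); last by lia.
  apply: eq_of_cross_addn (moment4_closed u t) _; rewrite /g.
  have -> : u * t - 2 = r + u + 2 by lia.
  have -> : r + u + 2 - (u.+1 + 1) = r by lia.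
  by rewrite ut; ring.
exact: computes_ret.
Qed.

(** * Digits *)

Lemma digits_lt B n (f : nat -> nat) :
  (forall i, i < n -> f i < B) -> \sum_(i < n) B ^ i * f i < B ^ n.
Proof.
elim: n => [|n IH] fB; first by rewrite big_ord0.
rewrite big_ord_recr /= expnS.
have := IH (fun i ni => fB i (ltnW ni)); have := fB n (leqnn _).
by set s := \sum_(i < n) _; set X := B ^ n; nia.
Qed.

(** Only the number whose digits all equal B - 1 reaches B ^ n - 1. *)
Lemma digits_lt_pred B n (f : nat -> nat) :
  (forall i, i < n.+1 -> f i < B) -> (f 0).+1 < B ->
  (\sum_(i < n.+1) B ^ i * f i).+1 < B ^ n.+1.
Proof.
move=> fB f0; rewrite big_ord_recl /= mul1n expnS.
under eq_bigr => i _ do rewrite expnS -mulnA.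
rewrite -big_distrr /=.
have := @digits_lt B n (fun i => f i.+1) (fun i ni => fB i.+1 ni).
by set s := \sum_(i < n) _; set X := B ^ n; nia.
Qed.

Lemma digit_extract B n (f : nat -> nat) k :
  (forall i, i < n -> f i < B) -> k < n ->
  (\sum_(i < n) B ^ i * f i) %/ B ^ k %% B = f k.
Proof.
elim: n f k => [|n IH] f k fB // kn.
have B0 : 0 < B by apply: leq_ltn_trans (fB k kn).
rewrite big_ord_recl /= mul1n.
under eq_bigr => i _ do rewrite expnS -mulnA.
rewrite -big_distrr /= addnC mulnC.
case: k kn => [|k] kn; first by rewrite divn1 modnMDl modn_small // fB.
rewrite expnS divnMA divnMDl // (divn_small (fB _ _)) // addn0.
by rewrite (IH (fun i => f i.+1)) // => i ni; apply: fB.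
Qed.

(** * Hamming weight *)

(** The sum of the binary digits; the positions from [m] on carry only zeros. *)
Definition hamming_weight (m : nat) := \sum_(i < m) odd (m %/ 2 ^ i).

Lemma hamming_weight_widen n m :
  m <= n -> hamming_weight m = \sum_(i < n) odd (m %/ 2 ^ i).
Proof.
move=> mn; rewrite -(subnKC mn) big_split_ord /= -[LHS]addn0; congr addn.
rewrite big1 // => i _; rewrite divn_small // (leq_trans (ltn_expl m (leqnn 2))) //.
by rewrite leq_exp2l // leq_addr.
Qed.

Lemma hamming_weight_bit (b : bool) m : hamming_weight (b + m.*2) = b + hamming_weight m.
Proof.
rewrite (@hamming_weight_widen (b + m.*2).+1) // big_ord_recl /= divn1 oddD odd_double.
rewrite addbF oddb (@hamming_weight_widen (b + m.*2)); last by lia.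
congr addn; apply: eq_bigr => i _; rewrite /bump /= add1n expnS divnMA.
by rewrite divn2 half_bit_double.
Qed.

Lemma hamming_weight0 : hamming_weight 0 = 0.
Proof. exact: big_ord0. Qed.

Lemma hamming_weight_cat k a b :
  a < 2 ^ k -> hamming_weight (a + 2 ^ k * b) = hamming_weight a + hamming_weight b.
Proof.
elim: k a => [|k IH] a ak.
  have -> : a = 0 by lia.
  by rewrite mul1n hamming_weight0.
have -> : a + 2 ^ k.+1 * b = odd a + (a./2 + 2 ^ k * b).*2.
  by rewrite expnS; lia.
rewrite hamming_weight_bit IH; last by rewrite expnS in ak; lia.
by rewrite addnA -hamming_weight_bit odd_double_half.
Qed.

Lemma hamming_weight_digits k n (f : nat -> nat) :
  (forall i, i < n -> f i < 2 ^ k) ->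
  hamming_weight (\sum_(i < n) (2 ^ k) ^ i * f i) = \sum_(i < n) hamming_weight (f i).
Proof.
elim: n => [|n IH] fk; first by rewrite !big_ord0 hamming_weight0.
rewrite !big_ord_recr /= -IH => [|i ni]; last exact: fk (ltnW ni).
by rewrite -expnM hamming_weight_cat // expnM digits_lt // => i ni; apply: fk (ltnW ni).
Qed.

(** Subtracting from 2 ^ w - 1 flips each of the w bits. *)
Lemma hamming_weight_compl w r :
  r < 2 ^ w -> hamming_weight r + hamming_weight (2 ^ w - 1 - r) = w.
Proof.
elim: w r => [|w IH] r rw; first by case: r rw => // _; rewrite hamming_weight0.
rewrite expnS in rw *.
have -> : 2 * 2 ^ w - 1 - r = ~~ odd r + (2 ^ w - 1 - r./2).*2 by lia.
rewrite -[in hamming_weight r](odd_double_half r) !hamming_weight_bit addnACA.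
by rewrite IH; lia.
Qed.

Lemma hamming_weight_ones w : hamming_weight (2 ^ w - 1) = w.
Proof.
by have := @hamming_weight_compl w 0 (expn_gt0 2 w); rewrite hamming_weight0 subn0.
Qed.

(** With s = r + 1, the product is 2 ^ w * r + (2 ^ w - 1 - r): the bits of r
    followed by their complements. *)
Lemma hamming_weight_mul_ones w s :
  0 < s <= 2 ^ w -> hamming_weight ((2 ^ w - 1) * s) = w.
Proof.
case: s => // r /= rw; rewrite -[RHS](@hamming_weight_compl w r rw) addnC.
rewrite -(@hamming_weight_cat w); last by lia.
by congr hamming_weight; nia.
Qed.

Lemma hamming_weight_le m : hamming_weight m <= m.
Proof.
rewrite -[leqRHS]card_ord -sum1_card; apply: leq_sum => i _; exact: leq_b1.
Qed.

(** Legendre's formula, by halving: the even factors of m! contribute (m/2)! and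
    one factor 2 each. *)
Lemma logn_fact_hamming m : logn 2 m`! + hamming_weight m = m.
Proof.
elim/ltn_ind: m => m IH; case: m IH => [|m] IH; first by rewrite hamming_weight0 logn1.
have half_lt : m.+1./2 < m.+1 by lia.
have logn_half k : logn 2 (k.*2)`! = k + logn 2 k`!.
  elim: k => [|k IHk] //.
  rewrite doubleS factS lognM ?fact_gt0 // factS lognM ?fact_gt0 //.
  rewrite IHk [in RHS]factS lognM ?fact_gt0 //.
  have -> : k.*2.+2 = 2 * k.+1 by lia.
  rewrite lognM // logn_prime // eqxx [logn 2 k.*2.+1]logn_coprime; first lia.
  by rewrite coprime2n /= odd_double.
have logn_m : logn 2 m.+1`! = logn 2 (m.+1./2.*2)`!.
  rewrite -[in LHS](odd_double_half m.+1).
  case: (odd m.+1) => //=; rewrite add1n factS lognM ?fact_gt0 //.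
  by rewrite logn_coprime // coprime2n /= odd_double.
rewrite logn_m logn_half -[in hamming_weight _](odd_double_half m.+1).
by rewrite hamming_weight_bit; have := IH _ half_lt; have := odd_double_half m.+1; lia.
Qed.

(** Kummer's theorem for the central binomial coefficient. *)
Lemma logn_central_bin m : logn 2 'C(m.*2, m) = hamming_weight m.
Proof.
have m2 : m <= m.*2 by lia.
have := congr1 (logn 2) (bin_fact m2).
have -> : m.*2 - m = m by lia.
rewrite !lognM ?fact_gt0 ?muln_gt0 ?fact_gt0 ?bin_gt0 //.
have := logn_fact_hamming m; have := logn_fact_hamming m.*2.
by have := hamming_weight_bit false m; rewrite !add0n; lia.
Qed.

(** * The Hamming-weight subroutine *)

(** With g the gcd, the lattice points are (k b / g, a - k a / g) for 0 <= k <= g. *)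
Lemma count_gcd a b : 0 < a -> 0 < b ->
  \sum_(i < b.+1) \sum_(j < a.+1) (a * i + b * j == a * b) = (gcdn a b).+1.
Proof.
move=> a0 b0; have g0 : 0 < gcdn a b by rewrite gcdn_gt0 a0.
have [a' Ea] := dvdnP (dvdn_gcdl a b); have [b' Eb] := dvdnP (dvdn_gcdr a b).
have co : coprime b' a'.
  by rewrite coprime_sym /coprime -(eqn_pmul2r g0) mul1n muln_gcdl -Ea -Eb.
move: (gcdn a b) Ea Eb g0 => g Ea Eb g0.
have inner (i : 'I_b.+1) : \sum_(j < a.+1) (a * i + b * j == a * b) = (b' %| i) :> nat.
  have [/dvdnP[k Ek]|ndvd] := boolP (b' %| i).
    have eq_ab (j : nat) : (a * i + b * j == a * b) = (j == a - k * a').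
      have -> : a * i = b * (k * a') by rewrite Ek Ea Eb; ring.
      have : k * a' <= a.
        rewrite -(leq_pmul2l b0); have := ltn_ord i; rewrite ltnS => ib.
        apply: leq_trans (_ : a * i <= _); last by rewrite mulnC leq_mul2r ib orbT.
        by rewrite Ek Ea Eb; apply: eq_leq; ring.
      by rewrite [a * b]mulnC -mulnDr eqn_pmul2l //; lia.
    have ja : a - k * a' < a.+1 by lia.
    rewrite (bigD1 (Ordinal ja)) //= eq_ab eqxx big1 // => j jN.
    by rewrite eq_ab; move: jN; rewrite -val_eqE /= => /negbTE->.
  rewrite big1 // => j _; case: eqP => // E; case/negP: ndvd.
  rewrite -(Gauss_dvdr _ co) -(dvdn_pmul2r g0) mulnAC -Ea -Eb.
  by rewrite -(dvdn_addl _ (dvdn_mulr j (dvdnn b))) E dvdn_mull.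
rewrite (eq_bigr _ (fun i _ => inner i)) big_ord_recl /= dvdn0.
rewrite -add1n; congr addn.
rewrite -(big_mkord predT (fun i => (b' %| i.+1) : nat)).
rewrite -(big_add1 _ _ 0 b.+1 predT (fun i => (b' %| i) : nat)).
have b'0 : 0 < b' by case: b' Eb {co inner} => // Eb; rewrite Eb in b0.
by rewrite -divn_count_dvd [X in X %/ _]Eb mulKn.
Qed.

(** The quotient has the expansion sum x ^ (a b - a i - b j) over all i, j >= 0, so that its
    units digit in base x counts the solutions of a i + b j = a b.  To stay
    with finite sums, one multiplies it by x ^ (a b) and compares it with the
    product of the truncated progressions i <= b and j <= a: replacing (i, j) by
    (b - i, a - j), the terms of exponent at least a b give the integer part [h], and
    the others, [l], together with the truncation error [r], stay below one unit. *)
Lemma gcd_digit x a b : 0 < a -> 0 < b -> 4 * (a * b) + 8 < x ->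
  x ^ (a * b + a + b) %/ ((x ^ a - 1) * (x ^ b - 1)) %% x = (gcdn a b).+1.
Proof.
move=> a0 b0 x_big; set n := a * b in x_big *; have n0 : 0 < n by rewrite muln_gt0 a0.
have x0 : 0 < x by lia.
pose e i j := a * i + b * j.
pose hi i j := if n < e i j then x ^ (e i j - n).-1 else 0.
pose lo i j := if e i j < n then x ^ e i j else 0.
pose h := \sum_(i < b.+1) \sum_(j < a.+1) ((e i j == n) + x * hi i j).
pose l := \sum_(i < b.+1) \sum_(j < a.+1) lo i j.
have split_e i j : x ^ e i j = x ^ n * ((e i j == n) + x * hi i j) + lo i j.
  rewrite /hi /lo; case: (ltngtP (e i j) n) => [_|ne|->].
  - by rewrite !muln0.
  - by rewrite add0n -expnS -expnD addn0; congr expn; lia.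
  - by rewrite muln0 !addn0 muln1.
pose E := \sum_(i < b.+1) (x ^ a) ^ i; pose F := \sum_(j < a.+1) (x ^ b) ^ j.
have EF : E * F = x ^ n * h + l.
  rewrite big_distrlr /= big_distrr /= -big_split; apply: eq_bigr => i _ /=.
  rewrite big_distrr /= -big_split; apply: eq_bigr => j _ /=.
  by rewrite -split_e expnD !expnM.
have xa0 : 0 < x ^ a by rewrite expn_gt0 x0.
have xb0 : 0 < x ^ b by rewrite expn_gt0 x0.
have geo_a : (x ^ a - 1) * E + 1 = x ^ n * x ^ a.
  rewrite subn1 -predn_exp -expnM mulnS expnD mulnC addn1 prednK //.
  by rewrite muln_gt0 xa0 expn_gt0 x0.
have geo_b : (x ^ b - 1) * F + 1 = x ^ n * x ^ b.
  rewrite subn1 -predn_exp -expnM mulnS expnD (mulnC b a) -/n [_ * x ^ n]mulnC.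
  by rewrite addn1 prednK // muln_gt0 xb0 expn_gt0 x0.
set D := (x ^ a - 1) * (x ^ b - 1).
have lx : l * x <= 4 * n * x ^ n.
  apply: (@leq_trans (\sum_(i < b.+1) \sum_(j < a.+1) x ^ n)).
    rewrite /l big_distrl; apply: leq_sum => i _ /=.
    rewrite big_distrl; apply: leq_sum => j _ /=.
    by rewrite /lo; case: ltnP => // en; rewrite -expnSr leq_exp2l //; lia.
  rewrite !sum_nat_const !card_ord mulnA leq_mul2r; apply/orP; right.
  by rewrite /n; nia.
pose r := x ^ n * x ^ a + x ^ n * x ^ b - 1.
have rx : r * x <= 8 * (x ^ n * D).
  have xaS : x <= x ^ a by rewrite -[leqLHS]expn1 leq_exp2l //; lia.
  have xbS : x <= x ^ b by rewrite -[leqLHS]expn1 leq_exp2l //; lia.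
  rewrite /r /D; move: (x ^ n) (x ^ a) (x ^ b) xaS xbS x_big => C u v xu xv xg.
  apply: (@leq_trans (C * (2 * (u * v)))).
    apply: (@leq_trans ((C * u + C * v) * x)); first by rewrite leq_mul2r leq_subr orbT.
    rewrite -mulnDr -mulnA leq_mul2l; apply/orP; right.
    by have := leq_mul (leqnn u) xv; have := leq_mul (leqnn v) xu; lia.
  rewrite [8 * _]mulnCA leq_mul2l; apply/orP; right.
  have [u' ->] : exists u', u = u' + 2 by exists (u - 2); lia.
  have [v' ->] : exists v', v = v' + 2 by exists (v - 2); lia.
  by rewrite -!addnBA //; nia.
have quot : x ^ (n + a + b) * x ^ n = (D * x ^ n) * h + (l * D + r).
  have r1 : r + 1 = x ^ n * x ^ a + x ^ n * x ^ b.
    by rewrite /r subnK // addn_gt0 muln_gt0 xa0 expn_gt0 x0.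
  have st : ((x ^ a - 1) * E) * ((x ^ b - 1) * F) = (D * x ^ n) * h + l * D.
    transitivity (D * (E * F)); first by rewrite /D; ring.
    by rewrite EF; ring.
  have -> : x ^ (n + a + b) * x ^ n = (x ^ n * x ^ a) * (x ^ n * x ^ b).
    by rewrite !expnD; ring.
  apply: (@addIn 1); rewrite -!addnA r1 addnA -st -geo_a -geo_b.
  by rewrite -/E -/F; ring.
have small : l * D + r < D * x ^ n.
  have D0 : 0 < D.
    rewrite muln_gt0 !subn_gt0 -[X in X < _ ^ a](expn0 x) -[X in X < _ ^ b](expn0 x).
    by rewrite !ltn_exp2l //; lia.
  have Dx0 : 0 < D * x ^ n by rewrite muln_gt0 D0 expn_gt0 x0.
  rewrite -(ltn_pmul2r x0).
  apply: (@leq_ltn_trans ((4 * n + 8) * (D * x ^ n))).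
    by have := leq_mul (leqnn D) lx; lia.
  by rewrite [X in _ < X]mulnC ltn_pmul2r.
have -> : x ^ (n + a + b) %/ D = h.
  by rewrite -(@divnMr (x ^ n)) ?expn_gt0 ?x0 //; apply: divn_euclid quot small.
pose rest := \sum_(i < b.+1) \sum_(j < a.+1) hi i j.
have -> : h = rest * x + (gcdn a b).+1.
  rewrite -(count_gcd a0 b0) /h /rest mulnC big_distrr -big_split /=.
  apply: eq_bigr => i _; rewrite big_distrr -big_split /=.
  by apply: eq_bigr => j _; rewrite addnC.
rewrite modnMDl modn_small // (leq_ltn_trans (_ : _ <= n.+1)) //; last by lia.
by rewrite ltnS (leq_trans (dvdn_leq a0 (dvdn_gcdl a b))) // leq_pmulr.
Qed.

Lemma bin_lt_exp2 n i : 0 < n -> 'C(n, i) < 2 ^ n.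
Proof.
case: n => // n _; elim: n i => [[|[|i]]|n IH [|i]] //.
  by rewrite bin0 -[X in X < _](expn0 2) ltn_exp2l.
by rewrite binS expnS; have := IH i; have := IH i.+1; lia.
Qed.

(** The digits of (L + 1) ^ n in base L are the binomial coefficients, as long as these
    are smaller than L. *)
Lemma central_bin_digit m : 0 < m ->
  (2 ^ (2 * m) + 1) ^ (2 * m) %/ (2 ^ (2 * m)) ^ m %% 2 ^ (2 * m) = 'C(2 * m, m).
Proof.
move=> m0; rewrite addnC expnDn.
under eq_bigr => i _ do rewrite exp1n mul1n mulnC.
apply: (@digit_extract _ _ (fun i => 'C(2 * m, i))); last by lia.
by move=> i _; apply: bin_lt_exp2; lia.
Qed.

Lemma gcdn_exp2 n a : 0 < n < 2 ^ a -> gcdn n (2 ^ a) = 2 ^ logn 2 n.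
Proof.
case/andP=> n0 na; have [o co En] := @pfactor_coprime 2 n isT n0.
have ha : logn 2 n <= a.
  rewrite -(@leq_exp2l 2) // (leq_trans _ (ltnW na)) // dvdn_leq //.
  by rewrite {2}En dvdn_mull.
rewrite {1}En -[in 2 ^ a](subnK ha) expnD -muln_gcdl.
have : coprime o (2 ^ (a - logn 2 n)) by rewrite coprimeXr // coprime_sym.
by rewrite /coprime => /eqP ->; rewrite mul1n.
Qed.

(** (1 + u) ^ h = 1 + h u modulo u ^ 2. *)
Lemma discrete_log u h : 1 < u -> h < u -> u.+1 ^ h %% u ^ 2 %/ u = h.
Proof.
move=> u1 hu.
have [c ->] : exists c, u.+1 ^ h = c * u ^ 2 + (h * u + 1).
  elim: h {hu} => [|h [c IH]]; first by exists 0.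
  by exists (c * u.+1 + h); rewrite expnS IH; ring.
rewrite modnMDl modn_small; last by rewrite -mulnn; nia.
by rewrite divnMDl ?divn_small ?addn0; lia.
Qed.

Lemma H_computes m : 0 < m -> computes predT (H m) (hamming_weight m).
Proof.
move=> m0; rewrite /H.
apply: computes_let => [|a Ea]; first by run_expr.
apply: computes_let => [|L EL]; first by run_expr.
have L0 : 0 < L by rewrite EL expn_gt0.
apply: computes_let => [|alpha]; first by run_expr; rewrite ?expn_gt0 ?L0.
rewrite EL Ea central_bin_digit // => Ealpha.
have alpha0 : 0 < alpha by rewrite Ealpha bin_gt0; lia.
have alphaL : alpha < L by rewrite Ealpha EL Ea bin_lt_exp2 //; lia.
have logn_alpha : logn 2 alpha = hamming_weight m.
  by rewrite Ealpha mul2n logn_central_bin.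
have L4 : 4 <= L by rewrite EL Ea mul2n -[4]/(2 ^ 2) leq_exp2l //; lia.
apply: computes_let => [|e ->]; first by run_expr.
apply: computes_let => [|Pi ->]; first by run_expr.
rewrite -Ea -EL.
apply: computes_let => [|gamma Egamma]; first by run_expr.
have alpha2 : 2 <= alpha.
  rewrite Ealpha; case: m m0 {Ea Ealpha logn_alpha} => // m _.
  by rewrite mul2n doubleS binS -[X in X < _]addn0 -addnS leq_add // bin_gt0; lia.
have gamma8 : 8 <= gamma by rewrite Egamma; nia.
have pow_pred_gt0 k : 0 < k -> 0 < 2 ^ (gamma * k) - 1.
  by move=> k0; rewrite subn_gt0 -[X in X < _](expn0 2) ltn_exp2l // muln_gt0; lia.
apply: computes_let => [|g].
  by run_expr; rewrite ?muln_gt0 ?pow_pred_gt0 ?expn_gt0.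
have exp2_big x : 8 <= x -> 4 * x + 8 < 2 ^ x.
  elim: x => // x IH; rewrite leq_eqVlt ltnS => /orP[/eqP<-//|/IH].
  by rewrite expnS; lia.
rewrite !expnM {2}Egamma gcd_digit // -?Egamma ?exp2_big // subSS subn0.
rewrite EL gcdn_exp2 -?EL ?alpha0 // logn_alpha => ->.
have h_lt : hamming_weight m < L - 1.
  have : 2 ^ hamming_weight m < 2 ^ a.
    by rewrite -EL -logn_alpha (leq_ltn_trans _ alphaL) // dvdn_leq // pfactor_dvdnn.
  by rewrite ltn_exp2l // => ha; have := ltn_expl a (leqnn 2); lia.
apply: computes_let => [|u ->]; first by run_expr.
rewrite -[X in computes _ _ X](discrete_log _ h_lt); last by lia.
(* The program raises 2 ^ h to the power a, which is L ^ h because L = 2 ^ a. *)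
have -> : (L - 1).+1 ^ hamming_weight m = (2 ^ hamming_weight m) ^ a.
  by rewrite -expnM mulnC expnM -EL; congr expn; lia.
by run_expr; rewrite ?expn_gt0 ?subn_gt0 //; lia.
Qed.

(** * Solutions of the Pell equation *)

(** The coordinates of (X + Y sqrt(d)) ^ n. *)
Fixpoint pell d X Y n : nat * nat :=
  if n is n'.+1 then
    let: (x, y) := pell d X Y n' in (X * x + d * Y * y, Y * x + X * y)
  else (1, 0).

Section Pell.
Variables d X Y : nat.
Hypotheses (d_gt1 : 1 < d) (XY_fund : fundamental_solution d X Y).

Local Notation px n := (pell d X Y n).1.
Local Notation py n := (pell d X Y n).2.

Lemma pxS n : px n.+1 = X * px n + d * Y * py n.
Proof. by rewrite /=; case: (pell d X Y n). Qed.

Lemma pyS n : py n.+1 = Y * px n + X * py n.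
Proof. by rewrite /=; case: (pell d X Y n). Qed.

Local Arguments pell : simpl never.

Lemma fundamental_eq : X ^ 2 = d * Y ^ 2 + 1.
Proof. by case: XY_fund => [[_ _ ?] _]; lia. Qed.

Lemma fundamental_Y_gt0 : 0 < Y.
Proof. by case: XY_fund => [[]]. Qed.

Lemma fundamental_X_gt1 : 1 < X.
Proof. by have := fundamental_eq; have := fundamental_Y_gt0; nia. Qed.

Lemma pell_eq n : px n ^ 2 = d * py n ^ 2 + 1.
Proof.
elim: n => [|n IH]; first by rewrite /=; ring.
rewrite pxS pyS; move: IH; set x := px n; set y := py n => IH.
have -> : (X * x + d * Y * y) ^ 2
          = X ^ 2 * x ^ 2 + d ^ 2 * Y ^ 2 * y ^ 2 + 2 * d * X * Y * x * y by ring.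
have -> : d * (Y * x + X * y) ^ 2 + 1
  = X ^ 2 * (d * y ^ 2) + d * Y ^ 2 * x ^ 2 + 2 * d * X * Y * x * y + 1 by ring.
by rewrite fundamental_eq IH; ring.
Qed.

Lemma px_gt0 n : 0 < px n.
Proof. by have := pell_eq n; case: (px n) => //; rewrite exp0n // addn1. Qed.

Lemma px_lt m n : m < n -> px m < px n.
Proof.
have step k : px k < px k.+1.
  by rewrite pxS; have := fundamental_X_gt1; have := px_gt0 k; nia.
elim: n => // n IH; rewrite ltnS leq_eqVlt => /orP[/eqP->|/IH] //.
by move=> /ltn_trans; apply.
Qed.

(** Descent: dividing a solution with y > 0 by the fundamental one, that is, multiplying
    it by X - Y sqrt(d), gives a solution with nonnegative coordinates and smaller x. *)
Lemma pell_complete x y : x ^ 2 = d * y ^ 2 + 1 -> exists n, x = px n /\ y = py n.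
Proof.
elim/ltn_ind: x y => x IH y E.
have [y0|y_gt0] := posnP y.
  by exists 0; split; rewrite //= -?y0 //; rewrite y0 in E; nia.
have x_gt0 : 0 < x by case: x E {IH} => //; rewrite exp0n // addn1.
have Xx : X <= x by case: XY_fund => _ /(_ x y); apply; split=> //; lia.
have Ef := fundamental_eq; have X1 := fundamental_X_gt1.
have Yy : Y <= y.
  rewrite -(@leq_exp2r _ _ 2) // -(@leq_pmul2l d); last by lia.
  have : X ^ 2 <= x ^ 2 by rewrite leq_exp2r.
  by lia.
have [x' Ex] : exists x', x * X = d * y * Y + x'.
  exists (x * X - d * y * Y); rewrite subnKC // -(@leq_exp2r _ _ 2) // [leqRHS]expnMn E Ef.
  have -> : (d * y * Y) ^ 2 = d * y ^ 2 * (d * Y ^ 2) by ring.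
  by apply: leq_mul; lia.
have [y' Ey] : exists y', y * X = x * Y + y'.
  exists (y * X - x * Y); rewrite subnKC // -(@leq_exp2r _ _ 2) // !expnMn E Ef.
  have : Y ^ 2 <= y ^ 2 by rewrite leq_exp2r.
  by rewrite mulnDl mulnDr; lia.
have Exx : x = X * x' + d * Y * y'.
  have h : X * (d * y * Y + x') = X * (x * X) by rewrite Ex.
  have h2 : d * Y * (x * Y + y') = d * Y * (y * X) by rewrite Ey.
  have h3 : x * X ^ 2 = x * (d * Y ^ 2 + 1) by rewrite Ef.
  by lia.
have Eyy : y = Y * x' + X * y'.
  have h : Y * (d * y * Y + x') = Y * (x * X) by rewrite Ex.
  have h2 : X * (x * Y + y') = X * (y * X) by rewrite Ey.
  have h3 : y * X ^ 2 = y * (d * Y ^ 2 + 1) by rewrite Ef.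
  by lia.
have E' : x' ^ 2 = d * y' ^ 2 + 1.
  have : (X * x' + d * Y * y') ^ 2 + d * Y ^ 2 * x' ^ 2 + X ^ 2 * (d * y' ^ 2)
       = d * (Y * x' + X * y') ^ 2 + X ^ 2 * x' ^ 2 + d * Y ^ 2 * (d * y' ^ 2) by ring.
  by rewrite -Exx -Eyy E Ef !mulnDl; lia.
have x'0 : 0 < x' by case: x' E' {Ex Exx Eyy} => //; rewrite exp0n // addn1.
have x'x : x' < x by rewrite Exx (leq_trans (ltn_Pmull X1 x'0)) // leq_addr.
have [n [nx ny]] := IH _ x'x _ E'.
by exists n.+1; rewrite pxS pyS -nx -ny.
Qed.

Definition pell_sum_x n := \sum_(i < n.+1) px i.
Definition pell_sum_y n := \sum_(i < n.+1) py i.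

(** (pell_sum_x n, pell_sum_y n) are the coordinates of 1 + e + ... + e ^ n, with
    e = X + Y sqrt(d); the recurrence is s_(n+1) = 1 + e s_n. *)
Lemma pell_sum_xS n :
  pell_sum_x n.+1 = 1 + X * pell_sum_x n + d * Y * pell_sum_y n.
Proof.
rewrite /pell_sum_x big_ord_recl -addnA; congr addn.
by rewrite !big_distrr -big_split; apply: eq_bigr => i _; rewrite lift0 pxS.
Qed.

Lemma pell_sum_yS n :
  pell_sum_y n.+1 = Y * pell_sum_x n + X * pell_sum_y n.
Proof.
rewrite /pell_sum_y big_ord_recl add0n.
by rewrite !big_distrr -big_split; apply: eq_bigr => i _; rewrite lift0 pyS.
Qed.

(** In terms of s = A + B sqrt(d) and its conjugate s', this is the equality of the
    coefficients of sqrt(d) in s' (s - 1) = e s (s' - 1), which holds for the geometric sum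
    s = 1 + e + ... + e ^ n because s' = e ^ -n s. *)
Lemma pell_sum_norm n (A := pell_sum_x n) (B := pell_sum_y n) :
  Y * A ^ 2 = Y * (A + d * B ^ 2) + (X + 1) * B.
Proof.
rewrite {}/A {}/B; elim: n => [|n IH].
  by rewrite /pell_sum_x /pell_sum_y !big_ord_recr !big_ord0 /=; ring.
rewrite pell_sum_xS pell_sum_yS; move: IH.
set A := pell_sum_x n; set B := pell_sum_y n => IH.
apply: eq_of_cross_addn IH _.
apply: (@eq_of_cross_addn (X ^ 2 * (Y * A ^ 2) + (d * Y ^ 2 + 1) * (Y * d * B ^ 2 + B))
          ((d * Y ^ 2 + 1) * (Y * A ^ 2) + X ^ 2 * (Y * d * B ^ 2 + B))); last by ring.
by rewrite fundamental_eq.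
Qed.

Definition on_pell a b := a ^ 2 == d * b ^ 2 + 1.

Lemma sum_on_pell M a (g : nat -> nat) y :
  a ^ 2 = d * y ^ 2 + 1 -> y < M ->
  \sum_(b < M) on_pell a b * g b = g y.
Proof.
move=> E yM; rewrite (bigD1 (Ordinal yM)) //= /on_pell E eqxx mul1n.
rewrite big1 ?addn0 // => b; rewrite -val_eqE /= => by_neq.
case: eqP => // /addIn /eqP; rewrite eqn_pmul2l; last by lia.
by rewrite eqn_exp2r // eq_sym (negbTE by_neq).
Qed.

(** Raising [K] by one adds a term exactly when [K] is the next x-coordinate. *)
Lemma pell_sums K M : 1 < K <= M -> exists n,
  [/\ px n < K <= px n.+1,
      \sum_(a < K) \sum_(b < M) on_pell a b * a = pell_sum_x n &
      \sum_(a < K) \sum_(b < M) on_pell a b * b = pell_sum_y n].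
Proof.
case/andP; elim: K => // K IH; rewrite ltnS leq_eqVlt => /orP[/eqP <-|K1] KM.
  have sol0 b : on_pell 0 b = false by rewrite /on_pell exp0n // addn1.
  have e1 : 1 ^ 2 = d * 0 ^ 2 + 1 by rewrite muln0.
  exists 0; rewrite /pell_sum_x /pell_sum_y !big_ord_recr !big_ord0 /=.
  rewrite (@sum_on_pell M 1 (fun=> 1) 0) ?(@sum_on_pell M 1 id 0) //; try lia.
  rewrite !big1 => [|b _|b _]; rewrite ?sol0 //.
  by split=> //; rewrite muln1 muln0 addn0 fundamental_X_gt1.
have [n [/andP[nK Kn] Ex Ey]] := IH K1 (ltnW KM).
rewrite !big_ord_recr /= Ex Ey.
have [eK|neK] := eqVneq K (px n.+1).
  have pyM : py n.+1 < M by have := pell_eq n.+1; rewrite -eK; nia.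
  exists n.+1; split.
  - by rewrite ltnS eK leqnn px_lt.
  - by rewrite (@sum_on_pell M K (fun=> K) (py n.+1)) // ?[RHS]big_ord_recr -?eK // eK pell_eq.
  - by rewrite (@sum_on_pell M K id (py n.+1)) // ?[RHS]big_ord_recr // eK pell_eq.
have noK b : on_pell K b = false.
  apply/negP => /eqP /pell_complete [m [Km _]].
  have [mn|nm] := leqP m n.
    by move: nK; rewrite Km; move: mn; rewrite leq_eqVlt => /orP[/eqP->|/px_lt]; lia.
  move: nm; rewrite leq_eqVlt => /orP[/eqP e|/px_lt]; last by lia.
  by rewrite Km e eqxx in neK.
exists n; rewrite ![\sum_(b < M) on_pell K _ * _]big1 => [|b _|b _]; rewrite ?noK //.
by rewrite !addn0; split=> //; lia.
Qed.

End Pell.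

(** The hypotheses on [A] and [B] amount to c Y = (X + 1) B for c = A^2 - A - d B^2.
    Multiplied by Y^2, the common denominator c^2 - d B^2 becomes 2 (X + 1) B^2, and the
    numerators become X and Y times that, so both divisions are exact. *)
Lemma R_computes (S : pred nat) d X Y A B N :
  X ^ 2 = d * Y ^ 2 + 1 -> 0 < Y -> 0 < B ->
  Y * A ^ 2 = Y * (A + d * B ^ 2) + (X + 1) * B ->
  1 < N -> d <= N -> A <= N -> B <= N -> (forall v, v <= N ^ 20 -> S v) ->
  computes S (R d A B) (X, Y).
Proof.
move=> Exy Y0 B0 EAB N1 dN AN BN Sle.
have S_bd m v : v <= N ^ m -> m <= 20 -> S v.
  by move=> vm mK; apply: Sle; apply: leq_pow_trans N1 vm mK.
rewrite /R.
do 2 (apply: computes_let => [|? ->]; first by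
  (run_expr; (eapply S_bd; [bound | lia]))).
set c := A * A - A - d * (B * B).
have cN : c <= N ^ 2 by do 2 apply: leq_powB; apply: (@leq_powM N 1 1).
have cY : c * Y = (X + 1) * B.
  by rewrite mulnC !mulnBr mulnn EAB; lia.
have Y2 : 0 < Y ^ 2 by rewrite expn_gt0 Y0.
have ccY : (c * c) * Y ^ 2 = B ^ 2 * (X ^ 2 + 2 * X + 1).
  transitivity ((c * Y) ^ 2); first by ring.
  by rewrite cY; ring.
have [D ccD] : exists D, c * c = D + d * (B * B).
  exists (c * c - d * (B * B)); rewrite subnK // -(leq_pmul2r Y2) ccY Exy.
  by rewrite -mulnn -mulnn; lia.
have DY : D * Y ^ 2 = B ^ 2 * (2 * X + 2).
  apply: (@addnI (d * Y ^ 2 * (B * B))).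
  transitivity (c * c * Y ^ 2); first by rewrite ccD; ring.
  by rewrite ccY Exy; ring.
have D0 : 0 < D by rewrite -(ltn_pmul2r Y2) DY mul0n muln_gt0 expn_gt0 B0 addn2.
do 2 (apply: computes_let => [|? ->]; first by
  (run_expr; (eapply S_bd; [bound | lia]))).
rewrite ccD addnK -ccD.
have quot_x : c * c + d * (B * B) = X * D.
  apply/eqP; rewrite -(eqn_pmul2r Y2); apply/eqP.
  transitivity (B ^ 2 * (X ^ 2 + 2 * X + 1) + d * Y ^ 2 * (B * B)).
    by rewrite mulnDl ccY; ring.
  transitivity (B ^ 2 * (X ^ 2 + 2 * X + (d * Y ^ 2 + 1))); first by ring.
  by rewrite -Exy -mulnA DY; ring.
have quot_y : 2 * B * c = Y * D.
  apply/eqP; rewrite -(eqn_pmul2r Y0); apply/eqP.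
  transitivity (2 * B * (c * Y)); first by ring.
  rewrite cY; transitivity (B ^ 2 * (2 * X + 2)); first by ring.
  by rewrite -DY; ring.
do 2 (apply: computes_let => [|? ->]; first by
  (run_expr; first [exact: D0 | (eapply S_bd; [bound | lia])])).
by rewrite quot_x quot_y !mulnK //; apply: computes_ret.
Qed.

(** * The cells of the packed integers *)

(** The square (a ^ 2 - d * b ^ 2 - 1) ^ 2 over the integers: at most one of the two
    truncated differences is nonzero. *)
Definition pell_defect d a b := (a ^ 2 - (d * b ^ 2 + 1)) ^ 2 + (d * b ^ 2 + 1 - a ^ 2) ^ 2.

Lemma sqr_dist m n : (m - n) ^ 2 + (n - m) ^ 2 + 2 * m * n = m ^ 2 + n ^ 2.
Proof.
case: (leqP m n) => [mn|/ltnW mn]; rewrite -(subnK mn) (eqP (leq_addl _ _));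
 rewrite addnK; ring.
Qed.

Lemma pell_defectE d a b :
  pell_defect d a b + 2 * a ^ 2 * (d * b ^ 2 + 1) = a ^ 4 + (d * b ^ 2 + 1) ^ 2.
Proof. by rewrite sqr_dist -expnM. Qed.

Lemma pell_defect_eq0 d a b : (pell_defect d a b == 0) = on_pell d a b.
Proof. by rewrite addn_eq0 !expn_eq0 !andbT !subn_eq0 -eqn_leq. Qed.

Lemma pell_defect_le d K a b : 0 < d -> a < K -> b < K -> pell_defect d a b <= d ^ 2 * K ^ 4.
Proof.
move=> d0 aK bK; have -> : d ^ 2 * K ^ 4 = (d * K ^ 2) ^ 2 by ring.
have ha : a ^ 2 <= d * K ^ 2.
  by apply: (@leq_trans (K ^ 2)); rewrite ?leq_pmull // leq_exp2r // ltnW.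
have hb : d * b ^ 2 + 1 <= d * K ^ 2.
  have : b ^ 2 < K ^ 2 by rewrite ltn_exp2r.
  by move=> h; rewrite addn1 ltn_pmul2l.
rewrite /pell_defect; case: (leqP (a ^ 2) (d * b ^ 2 + 1)) => [h|/ltnW h].
  by rewrite (eqP h) leq_exp2r //; lia.
by rewrite (eqP h) addn0 leq_exp2r //; lia.
Qed.

Definition cell P d a b := (P - 1) * (P + 1 - pell_defect d a b).

Lemma hamming_weight_cell w d a b : 0 < w -> pell_defect d a b <= 2 ^ w ->
  hamming_weight (cell (2 ^ w) d a b) = w + on_pell d a b * w.
Proof.
move=> w0 dw; rewrite /cell -pell_defect_eq0; have := dw; case: eqP => [-> _|/eqP d0 _].
  rewrite subn0 -[RHS]/(w + 1 * w) mul1n addnn -mul2n -[RHS]hamming_weight_ones.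
  by congr hamming_weight; rewrite -subn_sqr exp1n -expnM mulnC.
by rewrite addn0 hamming_weight_mul_ones //; lia.
Qed.

Lemma cell_lt_sqr P d a b : 1 < P -> cell P d a b < P ^ 2.
Proof.
move=> P1; apply: (@leq_ltn_trans ((P - 1) * (P + 1))); first by rewrite leq_mul2l leq_subr orbT.
by rewrite -subn_sqr exp1n subn1 ltn_predL expn_gt0; lia.
Qed.

(** The defect of (0, 0) is 1, which makes this cell smaller than the largest digit. *)
Lemma cell00_lt_sqr P d : 1 < P -> (cell P d 0 0).+1 < P ^ 2.
Proof. by move=> P1; rewrite /cell /pell_defect muln0 !exp1n add0n addnK -mulnn; nia. Qed.

(** * Combining the moments *)

Section DoubleSum.
Variables K R B : nat.

Definition dsum (f : nat -> nat -> nat) :=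
  \sum_(a < K) \sum_(b < K) R ^ a * B ^ b * f a b.

Lemma dsumD f g : dsum f + dsum g = dsum (fun a b => f a b + g a b).
Proof.
rewrite -big_split; apply: eq_bigr => a _; rewrite /= -big_split.
by apply: eq_bigr => b _; rewrite /= -mulnDr.
Qed.

Lemma dsumM k f : k * dsum f = dsum (fun a b => k * f a b).
Proof.
rewrite big_distrr; apply: eq_bigr => a _; rewrite big_distrr.
by apply: eq_bigr => b _; rewrite /= mulnCA.
Qed.

Lemma moment_mul i j : moment K i R * moment K j B = dsum (fun a b => a ^ i * b ^ j).
Proof.
rewrite big_distrlr; apply: eq_bigr => a _; apply: eq_bigr => b _ /=; ring.
Qed.

End DoubleSum.

(** Expanding the square in P + 1 - (a^2 - d b^2 - 1)^2 gives
    P - a^4 + 2 a^2 + 2 d a^2 b^2 - 2 d b^2 - d^2 b^4, a combination of monomials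
    a^i b^j whose weighted sums are products of moments. *)
Lemma T_computes (S : pred nat) d P K R B N n :
  (forall a b, a < K -> b < K -> pell_defect d a b <= P) ->
  K ^ 4 <= P -> d <= N -> P <= N -> 1 < N ->
  (forall j, j <= 4 -> moment K j R <= N ^ n) ->
  (forall j, j <= 4 -> moment K j B <= N ^ n) ->
  (forall m v, v <= N ^ m -> m <= 4 * n + 20 -> S v) ->
  computes S
    (T d (d * d) P (P - 1) (moment K 0 R, moment K 2 R, moment K 4 R)
       (moment K 0 B, moment K 2 B, moment K 4 B))
    (\sum_(a < K) R ^ a * \sum_(b < K) B ^ b * cell P d a b).
Proof.
move=> dP KP dN PN N1 UN VN S_bd.
have key : moment K 0 B * (P * moment K 0 R) +
    2 * moment K 2 R * (moment K 0 B + d * moment K 2 B)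
  = dsum K R B (fun a b => P + 1 - pell_defect d a b) + moment K 0 B * moment K 4 R
    + moment K 0 R * (2 * (d * moment K 2 B) + d * d * moment K 4 B).
  transitivity (P * (moment K 0 R * moment K 0 B) + 2 * (moment K 2 R * moment K 0 B)
    + (2 * d) * (moment K 2 R * moment K 2 B)); first by ring.
  rewrite -[RHS]addnA.
  transitivity (dsum K R B (fun a b => P + 1 - pell_defect d a b)
    + (moment K 4 R * moment K 0 B + (2 * d) * (moment K 0 R * moment K 2 B)
       + (d * d) * (moment K 0 R * moment K 4 B))); last by ring.
  rewrite !moment_mul !dsumM !dsumD; apply: eq_bigr => a _; apply: eq_bigr => b _.
  congr muln; have := dP _ _ (ltn_ord a) (ltn_ord b); have := pell_defectE d a b.
  move: (pell_defect _ _ _) => e Ee eP.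
  apply: eq_of_cross_addn Ee _.
  have -> : P + 1 - e = P - e + 1 by lia.
  rewrite -{1}(subnK eP); ring.
have U4 : moment K 4 R <= P * moment K 0 R.
  rewrite /moment big_distrr; apply: leq_sum => a _ /=; rewrite mul1n leq_mul2r.
  apply/orP; right; apply: leq_trans KP; rewrite leq_exp2r //; exact: ltnW.
have -> : \sum_(a < K) R ^ a * \sum_(b < K) B ^ b * cell P d a b
  = (P - 1) * dsum K R B (fun a b => P + 1 - pell_defect d a b).
  rewrite dsumM; apply: eq_bigr => a _; rewrite big_distrr; apply: eq_bigr => b _ /=.
  by rewrite mulnA.
have -> : dsum K R B (fun a b => P + 1 - pell_defect d a b) =
  (moment K 0 B * (P * moment K 0 R - moment K 4 R) +
    2 * moment K 2 R * (moment K 0 B + d * moment K 2 B))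
    - moment K 0 R * (2 * (d * moment K 2 B) + d * d * moment K 4 B).
  rewrite mulnBr; have := leq_mul (leqnn (moment K 0 B)) U4; move: key.
  move: (_ * (P * _)) (2 * _ * _) (moment K 0 R * _) (_ * moment K 4 R); lia.
have := (UN 0 isT, UN 2 isT, UN 4 isT, VN 0 isT, VN 2 isT, VN 4 isT).
move=> [[[[[U0N U2N] U4N] V0N] V2N] V4N].
rewrite /T; apply: computes_let => [|? ->].
  by run_expr; (eapply S_bd; [bound | lia]).
by run_expr; (eapply S_bd; [bound | lia]).
Qed.

(** * The packed integers *)

Definition packed q K (c : nat -> nat -> nat) :=
  (\sum_(i < K) (q ^ K * (q ^ K) ^ K) ^ i * \sum_(j < K) q ^ j * c i j)
    %/ ((q ^ K) ^ K - 1).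

(** Each (q ^ K) ^ i is q ^ K - 1 times a geometric series with i terms, plus 1.  The
    leftover ones add up to a number with K digits in base q, not all of them equal
    to q - 1, hence less than the divisor q ^ K - 1. *)
Lemma divide_packed q K (F : nat -> nat) :
  0 < K -> (forall i, i < K -> F i < q) -> (F 0).+1 < q ->
  (\sum_(i < K) (q * q ^ K) ^ i * F i) %/ (q ^ K - 1) =
  \sum_(l < K) (q ^ K) ^ l * \sum_(i < K) q ^ i * ((l < i) * F i).
Proof.
case: K => // K _ Fq F0; set q2 := q ^ K.+1.
have small := digits_lt_pred Fq F0; rewrite -/q2 in small.
apply: (@divn_euclid _ _ _ (\sum_(i < K.+1) q ^ i * F i)); last by lia.
under [X in _ = _ * X + _]eq_bigr => l _ do rewrite big_distrr.
rewrite exchange_big big_distrr -big_split; apply: eq_bigr => i _ /=.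
under eq_bigr => l _ do rewrite mulnCA (mulnA (q2 ^ l)) mulnCA.
rewrite -big_distrl /= expnMn.
have -> : \sum_(l < K.+1) q2 ^ l * (l < i) = \sum_(l < i) q2 ^ l.
  rewrite (big_ord_widen K.+1 (fun l => q2 ^ l)); last exact: ltnW.
  by rewrite [RHS]big_mkcond; apply: eq_bigr => l _; case: ifP => _; rewrite ?muln1 ?muln0.
have : q2 ^ i = (q2 - 1) * \sum_(l < i) q2 ^ l + 1.
  by rewrite subn1 -predn_exp addn1 prednK // expn_gt0; apply/orP; left; lia.
by move: (\sum_(l < i) _) => s ->; ring.
Qed.

Lemma packed_hamming_weight k K (c : nat -> nat -> nat) (q := 2 ^ k) :
  0 < K -> (forall i j, i < K -> j < K -> c i j < q) -> (c 0 0).+1 < q ->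
  hamming_weight (packed q K c)
    = \sum_(i < K) \sum_(j < K) i * hamming_weight (c i j)
  /\ packed q K c < 2 ^ (k * K ^ 3).
Proof.
pose q1 := q ^ K; pose q2 := q1 ^ K; move=> K0 cq c00.
have Fq i : i < K -> \sum_(j < K) q ^ j * c i j < q1.
  by move=> iK; apply: digits_lt => j jK; apply: cq.
have F0 : (\sum_(j < K) q ^ j * c 0 j).+1 < q1.
  rewrite /q1; case: K K0 cq {q2 q1 Fq} => // K _ cq.
  by apply: digits_lt_pred => // j jK; apply: cq.
rewrite /packed -/q1 -/q2 (divide_packed K0 Fq F0) -/q2.
have gF l i : i < K -> (l < i) * (\sum_(j < K) q ^ j * c i j) < q1.
  by move=> iK; case: (l < i); rewrite ?mul1n ?mul0n ?Fq // expn_gt0 expn_gt0.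
have GF l : l < K -> \sum_(i < K) q1 ^ i * ((l < i) * \sum_(j < K) q ^ j * c i j) < q2.
  by move=> _; exact: (digits_lt (gF l)).
split; last first.
  by have := digits_lt GF; rewrite /q2 /q1 /q -!expnM; congr (_ < 2 ^ _); ring.
rewrite /q2 /q1 /q -?expnM in cq gF GF *.
rewrite (hamming_weight_digits GF).
under eq_bigr => l _ do rewrite (hamming_weight_digits (gF l)).
rewrite exchange_big; apply: eq_bigr => i _ /=.
transitivity (\sum_(l < K) (l < i) * \sum_(j < K) hamming_weight (c i j)).
  apply: eq_bigr => l _; case: (l < i); rewrite ?mul0n ?hamming_weight0 // !mul1n.
  by apply: hamming_weight_digits => j jK; apply: cq.
rewrite -big_distrl /= -big_distrr /=; congr muln.
transitivity (\sum_(l < i) 1); last by rewrite sum1_card card_ord.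
rewrite (big_ord_widen K (fun=> 1)); last exact: ltnW.
rewrite [RHS]big_mkcond.
by apply: eq_bigr => l _; case: (l < i).
Qed.

Lemma sum_ord_double K : 2 * (\sum_(i < K) i) = K * (K - 1).
Proof.
elim: K => [|K IH]; rewrite ?big_ord0 // big_ord_recr /= mulnDr IH.
by case: K {IH} => // K; rewrite !subSS !subn0; lia.
Qed.

Lemma cells_hamming_weight w K (f : nat -> nat -> nat) (on : nat -> nat -> bool) :
  (forall i j, i < K -> j < K -> f i j = w + on i j * w) ->
  \sum_(i < K) \sum_(j < K) i * f i j =
  w * ((K * K * (K - 1)) %/ 2 + \sum_(i < K) \sum_(j < K) on i j * i).
Proof.
move=> fE; have -> : (K * K * (K - 1)) %/ 2 = \sum_(i < K) \sum_(j < K) i.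
  rewrite -mulnA -sum_ord_double mulnCA mulKn // big_distrr; apply: eq_bigr => i _ /=.
  by rewrite sum_nat_const card_ord.
rewrite -big_split big_distrr; apply: eq_bigr => i _ /=.
rewrite -big_split big_distrr; apply: eq_bigr => j _ /=.
by rewrite fE //; ring.
Qed.

(** * The program *)

Lemma binary_digits_lt v n : 0 < n -> v < 2 ^ n -> binary_digits v <= n.
Proof.
move=> n0 vn; have [->|v0] := posnP v; first by rewrite /binary_digits trunc_log0.
by rewrite -(@ltn_exp2l 2) // (leq_ltn_trans (trunc_logP _ v0)).
Qed.

(** The cell (i, j) occurs i times in the packed integer.  Counted with this
    multiplicity, the weight w of all the cells adds up to w * sigma, and the second w
    carried by the solutions adds up to w times the sum of their coordinates. *)
Lemma pell_packed_weights d K w X1 Y1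
    (c := cell (2 ^ w) d) (q := 2 ^ (2 * w)) (sigma := (K * K * (K - 1)) %/ 2) :
  2 <= d -> fundamental_solution d X1 Y1 -> X1 < K -> 0 < w ->
  d ^ 2 * K ^ 4 <= 2 ^ w ->
  exists A B,
    [/\ 0 < A <= K ^ 3, 0 < B <= K ^ 3,
        Y1 * A ^ 2 = Y1 * (A + d * B ^ 2) + (X1 + 1) * B,
        hamming_weight (packed q K c) = w * (sigma + A)
          /\ packed q K c < 2 ^ (2 * w * K ^ 3) &
        hamming_weight (packed q K (fun i j => c j i)) = w * (sigma + B)
          /\ packed q K (fun i j => c j i) < 2 ^ (2 * w * K ^ 3)].
Proof.
move=> d2 fund XK w0 Pbig.
have X1_gt1 := fundamental_X_gt1 d2 fund.
have K0 : 0 < K by lia.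
have P1 : 1 < 2 ^ w by rewrite -[X in X < _](expn0 2) ltn_exp2l.
have qE : q = (2 ^ w) ^ 2 by rewrite -expnM mulnC.
have c_q i j : i < K -> j < K -> c i j < q by move=> _ _; rewrite qE cell_lt_sqr.
have c00_q : (c 0 0).+1 < q by rewrite qE cell00_lt_sqr.
have hwE i j : i < K -> j < K -> hamming_weight (c i j) = w + on_pell d i j * w.
  move=> iK jK; rewrite hamming_weight_cell //; apply: leq_trans Pbig.
  by apply: pell_defect_le => //; apply: ltnW.
have hwE' i j : i < K -> j < K -> hamming_weight (c j i) = w + on_pell d j i * w.
  by move=> iK jK; apply: hwE.
have KK : 1 < K <= K by rewrite leqnn; lia.
have [n [/andP[nK Kn] Ax By]] := pell_sums d2 fund KK.
(* The fundamental solution itself is counted, so that neither sum vanishes. *)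
have n0 : 0 < n.
  case: n Kn {nK Ax By} => // Kn.
  by rewrite /= muln1 muln0 addn0 leqNgt XK in Kn.
have A_gt0 : 0 < pell_sum_x d X1 Y1 n by rewrite /pell_sum_x big_ord_recl addn_gt0.
have B_gt0 : 0 < pell_sum_y d X1 Y1 n.
  case: n n0 {nK Kn Ax By A_gt0} => // n _; rewrite pell_sum_yS addn_gt0.
  by rewrite muln_gt0 (fundamental_Y_gt0 fund) /pell_sum_x big_ord_recl addn_gt0.
have on_sum_le (g : 'I_K -> 'I_K -> 'I_K) :
    \sum_(a < K) \sum_(b < K) on_pell d a b * g a b <= K ^ 3.
  have sumK (f : 'I_K -> nat) m : (forall a, f a <= m) -> \sum_a f a <= K * m.
    move=> fm; rewrite -[X in X * m](card_ord K) -sum_nat_const.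
    by apply: leq_sum => a _; apply: fm.
  apply: (sumK) => a; apply: (sumK) => b.
  by case: on_pell; rewrite ?mul0n // mul1n ltnW.
exists (pell_sum_x d X1 Y1 n), (pell_sum_y d X1 Y1 n); split.
- by rewrite A_gt0 -Ax (on_sum_le (fun a _ => a)).
- by rewrite B_gt0 -By (on_sum_le (fun _ b => b)).
- exact: (pell_sum_norm d2 fund).
- have [-> lt] := packed_hamming_weight K0 c_q c00_q.
  by rewrite (cells_hamming_weight hwE) Ax.
have [-> lt] :=
  packed_hamming_weight (c := fun i j => c j i) K0 (fun i j iK jK => c_q j i jK iK) c00_q.
rewrite (cells_hamming_weight (on := fun i j => on_pell d j i) hwE').
by rewrite exchange_big By.
Qed.

Lemma QT_computes (S : pred nat) d K w X1 Y1 :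
  2 <= d -> fundamental_solution d X1 Y1 -> X1 < K -> 0 < w ->
  d ^ 2 * K ^ 4 <= 2 ^ w ->
  (forall v, v <= 2 ^ (120 * (w * K ^ 3)) -> S v) ->
  exists mx my,
    [/\ computes S (QT d K w) (Outcome mx my (X1, Y1)),
        mx < 2 ^ (2 * w * K ^ 3) & my < 2 ^ (2 * w * K ^ 3)].
Proof.
move=> d2 fund XK w0 Pbig Sle.
have X1_gt1 := fundamental_X_gt1 d2 fund.
have K1 : 1 < K by lia.
have K0 := ltnW K1.
pose P := 2 ^ w; pose q := 2 ^ (2 * w); pose q1 := q ^ K; pose q2 := q1 ^ K.
pose Q := q1 * q2.
have qE : P * P = q by rewrite mulnn /P -expnM mulnC.
have KP : K ^ 4 <= P by apply: leq_trans Pbig; rewrite leq_pmull // expn_gt0; lia.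
have dP : d <= P.
  apply: leq_trans Pbig.
  by rewrite -mulnn -mulnA leq_pmulr // muln_gt0 expn_gt0 K0; lia.
have P81 : 81 <= P by apply: leq_trans KP; rewrite -[81]/(3 ^ 4) leq_exp2r //; lia.
have KleP : K <= P.
  by apply: leq_trans KP; rewrite -[X in X <= _]expn1 leq_exp2l //; lia.
have Pq : P <= q by rewrite -qE leq_pmulr //; lia.
have q0 : 0 < q by lia.
have qq1 : q <= q1 by rewrite -[X in X <= _]expn1 leq_exp2l //; lia.
have q1q2 : q1 <= q2 by rewrite -[X in X <= _]expn1 leq_exp2l //; lia.
have q1Q : q1 <= Q by rewrite leq_pmulr //; lia.
have q2Q : q2 <= Q by rewrite leq_pmull //; lia.
have Q1 : 1 < Q by lia.
have dQ : d <= Q by lia.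
have KQ : K <= Q by lia.
have K3Q : K ^ 3 <= Q.
  apply: leq_trans q1Q; apply: leq_trans qq1; apply: leq_trans Pq.
  by apply: leq_trans KP; rewrite leq_exp2l.
have QE : Q = 2 ^ (2 * w * K + 2 * w * K * K).
  by rewrite /Q /q2 /q1 /q -!expnM expnD.
(* The exponents to come are of the form c K + c' with small constants; as K > 2,
   they are all at most 30 K. *)
have S_bd m v : v <= Q ^ m -> m <= 30 * K -> S v.
  move=> vm mK; apply: Sle; apply: leq_trans (leq_pow_trans Q1 vm mK) _.
  rewrite QE -expnM leq_exp2l //.
  have -> : (2 * w * K + 2 * w * K * K) * (30 * K) = w * (60 * K ^ 2 + 60 * K ^ 3)
    by ring.
  have -> : 120 * (w * K ^ 3) = w * (60 * K ^ 3 + 60 * K ^ 3) by ring.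
  by rewrite leq_mul2l leq_add2r leq_mul2l leq_exp2l ?orbT //; lia.
have defP a b : a < K -> b < K -> pell_defect d a b <= P.
  by move=> aK bK; apply: leq_trans Pbig; apply: pell_defect_le; lia.
pose Tx := \sum_(a < K) Q ^ a * \sum_(b < K) q ^ b * cell P d a b.
pose Ty := \sum_(b < K) Q ^ b * \sum_(a < K) q ^ a * cell P d a b.
pose sigma := (K * K * (K - 1)) %/ 2.
have [A [B [/andP[A0 AK] /andP[B0 BK] AB]]] := pell_packed_weights d2 fund XK w0 Pbig.
rewrite -[packed _ K (cell _ _)]/(Tx %/ (q2 - 1)) -[packed _ _ _]/(Ty %/ (q2 - 1)).
rewrite -/sigma => -[hwx ltx] [hwy lty].
have A_le := leq_trans AK K3Q; have B_le := leq_trans BK K3Q.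
have packed_bd v : v < 2 ^ (2 * w * K ^ 3) -> S v.
  move=> lt; apply: Sle; apply: leq_trans (ltnW lt) _.
  by rewrite leq_exp2l // -mulnA leq_mul2r orbC.
exists (Tx %/ (q2 - 1)), (Ty %/ (q2 - 1)); split=> //.
have runH m s : hamming_weight m = w * (sigma + s) -> m < 2 ^ (2 * w * K ^ 3) ->
    0 < s -> computes S (hide_inside (H m)) (w * (sigma + s)).
  move=> mE lt_m s0; rewrite -mE; apply: computes_hide.
    apply: H_computes; case: m mE {lt_m} => // /esym/eqP.
    by rewrite hamming_weight0 muln_eq0 addn_eq0 (gtn_eqF w0) (gtn_eqF s0) andbF.
  exact: packed_bd (leq_ltn_trans (hamming_weight_le _) lt_m).
have runHx := runH _ _ hwx ltx A0; have runHy := runH _ _ hwy lty B0.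
have Smx := packed_bd _ ltx; have Smy := packed_bd _ lty.
have runR : computes S (R d A B) (X1, Y1).
  apply: (R_computes (N := Q)) => //.
  - exact: (fundamental_eq d2 fund).
  - exact: fundamental_Y_gt0 fund.
  by move=> v vQ; apply: (S_bd _ _ vQ); rewrite (@leq_trans 30) ?leq_pmulr //.
have P_le : 2 ^ w <= Q ^ 1 by rewrite expn1; apply: leq_trans Pq (leq_trans qq1 q1Q).
have q1_le : q ^ K <= Q ^ 1 by [].
have q2_le : q1 ^ K <= Q ^ 1 by [].
have w_le : w <= Q ^ 1 by apply: leq_trans P_le; apply: ltnW; apply: ltn_expl.
clear Pbig QE K3Q AK BK AB ltx lty hwx hwy packed_bd runH.
rewrite /QT.
do 4 run_let S_bd; rewrite -/P qE.
run_let S_bd; rewrite -/q1.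
run_let S_bd; rewrite -/q2.
run_let S_bd; rewrite -/Q.
apply: computes_bind.
  apply: (@G024_computes S Q K None) => [||| v vQ]; try lia; first by left.
  by apply: (S_bd _ _ vQ); lia.
apply: computes_bind.
  (* The values for the base q are bounded by powers of the larger base Q. *)
  apply: (@G024_computes S q K (Some q1)) => [||| v vQ]; try lia; first by right.
  apply: (S_bd (K + 12)); last by lia.
  by apply: leq_trans vQ _; rewrite leq_exp2r; lia.
run_let S_bd.
have momentQ j : j <= 4 -> moment K j Q <= Q ^ (K + 4).
  move=> j4; apply: leq_trans (moment_le _ _ _) _; try lia.
  by rewrite leq_exp2l //; lia.
have momentq j : j <= 4 -> moment K j q <= Q ^ (K + 4).
  move=> j4; apply: leq_trans (moment_le _ _ _) _; try lia.
  apply: (@leq_trans (q ^ (K + 4))); first by rewrite leq_exp2l //; lia.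
  by rewrite leq_exp2r; lia.
apply: (@computes_bind _ _ _ _ _ Tx).
  apply: (T_computes (N := Q) (n := K + 4)) => //; try lia.
  by move=> m v vm mK; apply: (S_bd _ _ vm); lia.
apply: (@computes_bind _ _ _ _ _ Ty).
  have -> : Ty = \sum_(a < K) q ^ a * \sum_(b < K) Q ^ b * cell P d a b.
    rewrite /Ty; under eq_bigr => b _ do rewrite big_distrr.
    rewrite exchange_big; apply: eq_bigr => a _; rewrite big_distrr.
    by apply: eq_bigr => b _; rewrite /= mulnCA.
  apply: (T_computes (N := Q) (n := K + 4)) => //; try lia.
  by move=> m v vm mK; apply: (S_bd _ _ vm); lia.
have Dq0 : 0 < q2 - 1 by rewrite subn_gt0 (leq_trans _ q1q2) // (leq_trans _ qq1) //; lia.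
do 3 run_let S_bd.
apply: computes_bind runHx _; apply: computes_bind runHy _.
run_let S_bd; rewrite -/sigma.
have sigma_le : sigma <= Q ^ 3.
  apply: leq_pow_div; rewrite expnSr leq_mul ?(leq_trans (leq_subr _ _)) //.
  exact: leq_mul.
do 2 (apply: computes_let => [|? ->]; first by
  (run_expr; first [exact: w0 | rewrite ?mulKn // ; (eapply S_bd; [bound | lia])])).
rewrite !mulKn // !addKn.
apply: computes_bind runR _.
exact: computes_ret.
Qed.

Theorem theorem14 :
  exists C : nat, forall d K w X1 Y1 : nat,
    2 <= d -> (forall n : nat, d <> n ^ 2) ->
    fundamental_solution d X1 Y1 ->
    X1 < K -> 0 < w -> d ^ 2 * K ^ 4 <= 2 ^ w ->
    exists (r : outcome) (vals : seq nat),
      [/\ QT d K w = Some (r, vals),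
          output r = (X1, Y1),
          binary_digits (Mx r) <= 2 * w * K ^ 3
            /\ binary_digits (My r) <= 2 * w * K ^ 3
        & forall v : nat, v \in vals -> binary_digits v <= C * (w * K ^ 3)].
Proof.
exists 121 => d K w X1 Y1 d2 _ fund XK w0 Pbig.
have wK : 0 < w * K ^ 3 by rewrite muln_gt0 w0 expn_gt0 (leq_trans _ XK).
have [|mx [my [[vals run small] ltx lty]]] :=
  @QT_computes (fun v => binary_digits v <= 121 * (w * K ^ 3)) d K w X1 Y1 d2 fund XK w0 Pbig.
  move=> v vle; apply: binary_digits_lt; first by rewrite muln_gt0.
  by rewrite (leq_ltn_trans vle) // ltn_exp2l // ltn_pmul2r.
exists (Outcome mx my (X1, Y1)), vals; split=> //.
  by split; apply: binary_digits_lt; rewrite // -mulnA muln_gt0.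
by move=> v /(allP small).
Qed.
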